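(* Let $X$ and $Y$ be regular topological spaces and let $\alpha$ be a hereditarily closed, compact network on $X$. Then for each $f\in C_{\alpha}(X,Y)$, $$\psi\left(f,C_{\alpha}(X,Y)\right)\le w\alpha c(X)\cdot \sup_{A\in\alpha}\psi\left(f(A),Y\right)\cdot \sup_{A\in\alpha} w\left(f(A)\right).$$
   Context: Regular spaces are assumed to be $T_1$ (hence Hausdorff). A network on $X$ is a family $\alpha$ of subsets of $X$ such that for every open $U\subseteq X$ and every $x\in U$ there is $A\in\alpha$ with $x\in A\subseteq U$. A hereditarily closed, compact network on $X$ is a network $\alpha$ on $X$ such that each member of $\alpha$ is compact and each closed subset of a member of $\alpha$ is a member of $\alpha$. $C(X,Y)$ is the set of all continuous maps $X\to Y$. $C_{\alpha}(X,Y)$ is $C(X,Y)$ with the topology having as subbase the sets $[A,V]=\{f\in C(X,Y): f(A)\subseteq V\}$, where $A\in\alpha$ and $V$ is an open subset of $Y$. The weak $\alpha$-covering number of $X$ is $w\alpha c(X)=\min\{|\beta|:\beta\subseteq\alpha \text{ and } \bigcup\beta \text{ is dense in } X\}$. For a subset $A$ of a space $Z$, the pseudocharacter $\psi(A,Z)$ is the smallest cardinal $|\mathcal U|$, where $\mathcal U$ is a family of open subsets of $Z$ with $\bigcap\mathcal U=A$; one writes $\psi(z,Z)$ for $\psi(\{z\},Z)$. $w(Z)$ denotes the weight of $Z$; $f(A)$ carries the subspace topology from $Y$ in $w(f(A))$. All cardinal invariants are taken to be at least $\aleph_0$ (i.e. a finite value is replaced by $\aleph_0$). *)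

(* Defs.v *)
From HB Require Import structures.
From mathcomp Require Import all_boot all_classical topology.

Set Implicit Arguments.
Unset Strict Implicit.
Unset Printing Implicit Defensive.

Local Open Scope classical_set_scope.
Local Open Scope card_scope.

(* A cardinal number is represented by any type of that
    cardinality, so only statements invariant under bijection are meaningful. *)

Definition cardinal := Type.

Definition cardinal_le (K L : cardinal) : Prop := [set: K] #<= [set: L].

Definition is_least_cardinal (P : cardinal -> Prop) (K : cardinal) : Prop :=
  P K /\ forall L : cardinal, P L -> cardinal_le K L.

(* Cardinals being well-ordered, the default value [nat] is returned only when
   no cardinal satisfies [P] (for [P] invariant under bijection). *)
Definition least_cardinal (P : cardinal -> Prop) : cardinal :=
  if pselect (exists K, is_least_cardinal P K) is left e
  then projT1 (cid e) else nat.

Definition infinite_value (K : cardinal) : cardinal :=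
  if pselect (finite_set [set: K]) then nat : cardinal else K.

(* min {|b| : P b}, taken to be at least aleph_0. *)
Definition min_card (T : Type) (P : set (set T)) : cardinal :=
  infinite_value
    (least_cardinal (fun K => exists2 b : set T, P b & [set: K] #= b)).

(* The supremum is also taken among infinite cardinals; this only matters when
   [D] is empty, where it yields aleph_0 rather than 0. *)
Definition sup_card (I : Type) (D : set I) (K : I -> cardinal) : cardinal :=
  infinite_value
    (least_cardinal (fun L => forall i, D i -> cardinal_le (K i) L)).

Definition cardinal_mul (K L : cardinal) : cardinal := (K * L)%type.

Definition network (X : topologicalType) (alpha : set (set X)) : Prop :=
  forall (U : set X) (x : X), open U -> U x ->
    exists A, [/\ alpha A, A x & A `<=` U].

Definition hereditarily_closed_compact_network
    (X : topologicalType) (alpha : set (set X)) : Prop :=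
  [/\ network alpha,
      forall A, alpha A -> compact A &
      forall A B, alpha A -> closed B -> B `<=` A -> alpha B].

(* An alias of [continuousType X Y] carrying the topology generated by the
   subbase [set_open]; [alpha] only serves to select that topology. *)
Definition C_alpha (X Y : topologicalType) (alpha : set (set X)) : Type :=
  continuousType X Y.

Definition set_open (X Y : topologicalType) (alpha : set (set X))
    (AV : set X * set Y) : set (C_alpha Y alpha) :=
  [set f : continuousType X Y | f @` AV.1 `<=` AV.2].

HB.instance Definition _ (X Y : topologicalType) (alpha : set (set X)) :=
  Choice.copy (C_alpha Y alpha) (continuousType X Y).

HB.instance Definition _ (X Y : topologicalType) (alpha : set (set X)) :=
  @isSubBaseTopological.Build (C_alpha Y alpha) (set X * set Y)%type
    [set AV | alpha AV.1 /\ open AV.2] (@set_open X Y alpha).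

Definition C_alpha_image (X Y : topologicalType) (alpha : set (set X))
    (f : C_alpha Y alpha) (A : set X) : set Y :=
  (f : continuousType X Y) @` A.

Definition weak_covering_number (X : topologicalType) (alpha : set (set X)) :
    cardinal :=
  min_card [set beta : set (set X) |
    beta `<=` alpha /\ dense (\bigcup_(B in beta) B)].

Definition pseudocharacter (Z : topologicalType) (A : set Z) : cardinal :=
  min_card [set U : set (set Z) |
    U `<=` open /\ \bigcap_(V in U) V = A].

Definition weight (Z : topologicalType) : cardinal :=
  min_card [set B : set (set Z) | basis B].

(* Main.v *)
(* Let the members [A] of a family in [alpha] have dense union, let [B] range
   over a base of [f(A)], and let [V] range over open sets whose intersection is
   [f(A')], where [A' = A `&` f^-1(closure B)] is again a member of [alpha].
   The sets [A', V] isolate [f]: if [g] lies in all of them and [g x <> f x] for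
   some [x] in [A], then by regularity there is [B] containing [f x] whose
   closure misses [g x], whereas [g(A')] is included in [f(A')], hence in
   [closure B].  Thus [g = f] on a dense set.  Using the opens around [f(A')]
   rather than separating pairs of base elements keeps the count of these sets
   at a plain triple product, so that no [K * K = K] is needed. *)
Require Import Defs.
From HB Require Import structures.
From mathcomp Require Import all_boot all_classical topology.

Local Open Scope classical_set_scope.
Local Open Scope card_scope.

(** * Comparison of cardinals, minima and suprema *)

Lemma cardinal_leP (K L : cardinal) :
  cardinal_le K L <-> exists f : K -> L, injective f.
Proof.
rewrite /cardinal_le; split=> [|[f finj]].
  move=> /card_leP[g].
  exists (fun x => set_val (g (SigSub (in_setT x)))) => x y.
  move=> /val_inj/(@inj _ _ _ g); rewrite !inE /= => /(_ I I) h.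
  exact: (congr1 val h).
rewrite -(card_le_eql (inj_card_eq (f := f) (A := setT) _)); last first.
  by move=> x y _ _; apply: finj.
exact: card_leT.
Qed.

(* Zorn's lemma gives a maximal set of choice functions on which every projection
   is injective; by maximality some projection is onto its factor. *)
Lemma cardinal_family_least {I : Type} (K : I -> cardinal) (i0 : I) :
  exists i, forall j, cardinal_le (K i) (K j).
Proof.
pose C := forall i : I, K i.
pose Q := [set M : set C | forall x y i, M x -> M y -> x i = y i -> x = y].
have [|M [QM maxM]] := @Zorn_bigcup C Q.
  move=> F FQ Ftot x y i [M1 FM1 M1x] [M2 FM2 M2y] xy.
  have [M12|M21] := Ftot _ _ FM1 FM2.
    exact: (FQ _ FM2 x y i (M12 _ M1x)).
  exact: (FQ _ FM1 x y i M1x (M21 _ M2y)).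
have [i Mi] : exists i, forall a : K i, exists2 x, M x & x i = a.
  apply: contrapT => noi.
  have missed i : {a : K i | forall x, M x -> x i <> a}.
    apply: cid; apply: contrapT => noa; apply: noi; exists i => a.
    apply: contrapT => nox; apply: noa; exists a => x Mx xa.
    by apply: nox; exists x.
  pose y : C := fun i => sval (missed i).
  have yM x i : M x -> x i <> y i by move=> Mx; exact: (svalP (missed i)).
  (* [y] differs from every member of [M] at every coordinate, so [M] with [y] added stays in [Q];
     were [y] in [M], it would differ from itself at [i0]. *)
  apply: (maxM (M `|` [set y])).
    split=> [x Mx|sub]; first by left.
    exact: (yM y i0 (sub y (or_intror erefl))).
  move=> u v i [Mu|->] [Mv|->] uv //.
  - exact: QM uv.
  - by case: (yM _ i Mu).
  - by case: (yM _ i Mv).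
exists i => j; apply/cardinal_leP.
(* Each [a] in [K i] is lifted to a member of [M], which its [j]-th coordinate determines. *)
have /choice[h hP] : forall a, exists x, M x /\ x i = a.
  by move=> a; have [x] := Mi a; exists x.
exists (fun a => h a j) => a b hab.
have [Ma <-] := hP a; have [Mb <-] := hP b.
by rewrite (QM _ _ _ Ma Mb hab).
Qed.

Lemma cardinal_le_total (K L : cardinal) : cardinal_le K L \/ cardinal_le L K.
Proof.
have [[] least] := cardinal_family_least (fun b : bool => if b then K else L) true.
- by left; exact: (least false).
- by right; exact: (least true).
Qed.

(** It suffices to minimize over the subsets of one witness [K0]: any [L] satisfying [P] either
    dominates [K0] or is equipotent to a subset of it. *)
Lemma least_cardinalP (P : cardinal -> Prop) :
  (forall K L : cardinal, [set: K] #= [set: L] -> P K -> P L) ->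
  (exists K, P K) -> is_least_cardinal P (least_cardinal P).
Proof.
move=> Pinv [K0 PK0].
suff exP : exists K, is_least_cardinal P K.
  by rewrite /least_cardinal; case: pselect => // e; case: (cid e).
pose I := {S : set K0 | P (set_type S)}.
have PT : P (set_type [set: K0]).
  by apply: Pinv PK0; rewrite card_eq_sym; exact: card_setT.
have [[S PS] least] :=
  cardinal_family_least (fun S : I => set_type (sval S)) (exist _ setT PT).
exists (set_type S); split=> // L PL.
have [K0L|/cardinal_leP[f finj]] := cardinal_le_total K0 L.
  apply: card_le_trans K0L.
  by rewrite /cardinal_le (card_le_eql (card_setT S)); exact: card_leT.
have Lf : [set: L] #= [set: set_type (range f)].
  rewrite (card_eqr (card_setT (range f))) card_eq_sym.
  by apply: inj_card_eq => x y _ _; exact: finj.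
have := least (exist _ (range f) (Pinv _ _ Lf PL)).
by rewrite /cardinal_le /= -(card_le_eqr Lf).
Qed.

Lemma nat_le_infinite_value (K : cardinal) : cardinal_le nat (infinite_value K).
Proof.
rewrite /infinite_value; case: pselect => [?|infK]; first exact: card_lexx.
exact/infiniteP.
Qed.

Lemma le_infinite_value (K : cardinal) : cardinal_le K (infinite_value K).
Proof.
rewrite /infinite_value; case: pselect => [fK|?]; last exact: card_lexx.
exact: finite_set_countable.
Qed.

Lemma infinite_value_le (K L : cardinal) :
  cardinal_le nat L -> cardinal_le K L -> cardinal_le (infinite_value K) L.
Proof. by rewrite /infinite_value; case: pselect. Qed.

Lemma least_cardinal_min_cardP {T : Type} {P : set (set T)} {b : set T} :
  P b ->
  is_least_cardinal (fun K => exists2 c : set T, P c & [set: K] #= c)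
    (least_cardinal (fun K => exists2 c : set T, P c & [set: K] #= c)).
Proof.
move=> Pb; apply: least_cardinalP.
  move=> K L KL [c Pc Kc]; exists c => //.
  by apply: card_eq_trans Kc; rewrite card_eq_sym.
by exists (set_type b), b => //; exact: card_setT.
Qed.

Lemma min_card_le {T : Type} {P : set (set T)} {b : set T} {K : cardinal} :
  P b -> b #<= [set: K] -> cardinal_le nat K -> cardinal_le (min_card P) K.
Proof.
move=> Pb bK nK; apply: infinite_value_le => //.
have [_ least] := least_cardinal_min_cardP Pb.
apply: card_le_trans bK.
have /least h : exists2 c : set T, P c & [set: set_type b] #= c.
  by exists b => //; exact: card_setT.
by rewrite -(card_le_eqr (card_setT b)).
Qed.

Lemma min_card_attained {T : Type} {P : set (set T)} (K : cardinal) :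
  (exists b, P b) -> cardinal_le (min_card P) K ->
  exists2 b, P b & b #<= [set: K].
Proof.
move=> [b0 Pb0] minK.
have [[b Pb Lb] _] := least_cardinal_min_cardP Pb0.
exists b => //; rewrite -(card_le_eql Lb).
exact: card_le_trans (le_infinite_value _) minK.
Qed.

Lemma sup_card_ge {I : Type} {D : set I} (K : I -> cardinal) {i : I} :
  D i -> cardinal_le (K i) (sup_card D K).
Proof.
move=> Di; apply: card_le_trans (le_infinite_value _).
have [||ub _] := @least_cardinalP (fun L => forall i, D i -> cardinal_le (K i) L).
- by move=> L M LM KL j Dj; rewrite /cardinal_le -(card_le_eqr LM); exact: KL.
(* The disjoint sum is an upper bound, so the least one exists and no default value intervenes. *)
- exists {i : I & K i} => j Dj; apply/cardinal_leP.
  exists (existT K j) => x y xy.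
  have /= := projT2_eq xy.
  by rewrite (Prop_irrelevance (projT1_eq xy) erefl).
exact: ub.
Qed.

(** * Separation, density and enumerations of witnessing families *)

Lemma regular_accessible_separation {T : topologicalType} (x y : T) :
  accessible_space T -> regular_space T -> x <> y ->
  exists O : set T, [/\ open O, O x & ~ closure O y].
Proof.
move=> T1 T3 /eqP /T1[A [oA /[!inE] Ax Ay]].
have [V Vx VA] := T3 x A (open_nbhs_nbhs (conj oA Ax)).
exists V°; split; [exact: open_interior|exact: Vx|].
by move=> /(closureS (@interior_subset _ V))/VA.
Qed.

Lemma regular_accessible_hausdorff {T : topologicalType} :
  accessible_space T -> regular_space T -> hausdorff_space T.
Proof.
move=> T1 T3 x y xy; apply: contrapT => /(regular_accessible_separation _ _ T1 T3).
move=> [O [oO Ox nOy]].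
have [z [Oz]] := xy _ _ (open_nbhs_nbhs (conj oO Ox))
  (open_nbhs_nbhs (conj (closed_openC (@closed_closure _ O)) nOy)).
by apply; exact: subset_closure.
Qed.

(** Disjoint neighbourhoods of two differing values pull back to a nonempty open set on which [f]
    and [g] never agree; it would miss [D]. *)
Lemma dense_eq {T U : topologicalType} (D : set T) (f g : T -> U) :
  hausdorff_space U -> dense D -> continuous f -> continuous g ->
  {in D, f =1 g} -> f =1 g.
Proof.
rewrite open_hausdorff => U2 dD cf cg fg x; apply/eqP; apply: contrapT.
move=> /negP /U2[[A B] /= [/[!inE] Afx Bgx] [oA oB AB0]].
have [] := dD (f @^-1` A `&` g @^-1` B).
- by exists x.
- by apply: openI; apply: open_comp.
move=> z [[Az Bz] /mem_set Dz].
have : (A `&` B) (f z) by split=> //; rewrite fg.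
by rewrite AB0.
Qed.

(* The [e k] need not be open in [T]: they are base elements of the subspace [S],
   seen as subsets of [T]. *)
Lemma subspace_weight_enum {T : topologicalType} (S : set T) (K : cardinal) :
  cardinal_le (weight (set_type S)) K ->
  exists e : K -> set T, forall O y, open O -> S y -> O y ->
    exists k, e k y /\ e k `<=` O.
Proof.
move=> /min_card_attained[|B [_ Bbase] /pcard_surjP[e eB]].
  exists open; split=> // y A; rewrite nbhsE => -[O [oO Oy] OA].
  by exists O.
exists (fun k => set_val @` e k) => O y oO Sy Oy.
pose y' : set_type S := SigSub (mem_set Sy).
have [|V [BV Vy] VO] := Bbase y' (set_val @^-1` O).
  by apply: open_nbhs_nbhs; split=> //; exists O.
have [k _ ekV] := eB _ BV; exists k; rewrite ekV; split; first by exists y'.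
by move=> _ [z /VO Oz <-].
Qed.

Lemma pseudocharacter_enum {T : topologicalType} (S : set T) (K : cardinal) :
  accessible_space T -> cardinal_le (pseudocharacter S) K ->
  exists e : K -> set T, (forall k, open (e k)) /\ \bigcap_k e k = S.
Proof.
move=> T1 /min_card_attained[|F [Fopen capF] /pcard_surjP[e eF]].
  (* In a T1 space the complement of a point outside [S] is an open superset of [S], so the open
     supersets of [S] intersect in [S]. *)
  exists [set U | open U /\ S `<=` U]; split=> [U []//|].
  apply/seteqP; split=> [x Sx|x Sx U [_]]; last exact.
  apply: contrapT => nSx; apply: (Sx (~` [set x])) => //; split.
    exact/closed_openC/accessible_closed_set1.
  by move=> y Sy yx; apply: nSx; rewrite -yx.
(* [e] covers [F] but may take values outside it; replacing these by the whole space keeps the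
   intersection. *)
exists (fun k => if pselect (F (e k)) then e k else setT); split.
  by move=> k; case: pselect => [Fek|?]; [exact: Fopen|exact: openT].
rewrite -capF; apply/seteqP; split=> [x ex U FU|x Fx k _].
  have [k _ ekU] := eF _ FU.
  by have := ex k I; rewrite ekU; case: pselect.
by case: pselect => [FE|]; [exact: Fx|].
Qed.

Lemma weak_covering_number_enum {T : topologicalType} (alpha : set (set T)) :
  network alpha ->
  exists e : weak_covering_number alpha -> set T,
    dense (\bigcup_(k in [set k | alpha (e k)]) e k).
Proof.
move=> net.
have [|b [balpha bdense] /pcard_surjP[e eb]] :=
    @min_card_attained _ _ (weak_covering_number alpha) _ (card_lexx _).
  exists alpha; split=> // O [x Ox] oO.
  have [A [aA Ax _]] := net _ _ oO Ox.
  by exists x; split=> //; exists A.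
(* Values of [e] in [alpha] but outside [b] only enlarge the union, which stays dense. *)
exists e => O O0 oO; have [x [Ox [A bA Ax]]] := bdense _ O0 oO.
have [k _ ekA] := eb _ bA.
by exists x; split=> //; exists k; rewrite /= ekA //; exact: balpha.
Qed.

Lemma open_set_open {X Y : topologicalType} (alpha : set (set X))
    (A : set X) (V : set Y) :
  alpha A -> open V -> open (@set_open X Y alpha (A, V)).
Proof.
move=> aA oV.
exists [set @set_open X Y alpha (A, V)]; last by rewrite bigcup_set1.
by move=> _ ->; exact: finI_from1.
Qed.

(* The topology on [set_type S] is the subspace topology. *)
Theorem theorem2p1 (X Y : topologicalType)
    (X_T1 : @accessible_space X) (X_regular : @regular_space X)
    (Y_T1 : @accessible_space Y) (Y_regular : @regular_space Y)
    (alpha : set (set X))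
    (alpha_network : hereditarily_closed_compact_network alpha)
    (f : C_alpha Y alpha) :
  cardinal_le
    (pseudocharacter [set f])
    (cardinal_mul
      (cardinal_mul
        (weak_covering_number alpha)
        (sup_card alpha (fun A => pseudocharacter (C_alpha_image f A))))
      (sup_card alpha (fun A => weight (set_type (C_alpha_image f A))))).
Proof.
have [alpha_net alpha_compact alpha_closed] := alpha_network.
set Kc := weak_covering_number alpha; set Kp := sup_card _ _.
set Kw := sup_card _ _.
pose h : X -> Y := (f : continuousType X Y).
have cth : continuous h by exact: cts_fun.
(* Bounding by the supremum lets the single type [Kp] index the open sets around [f(A)] for every
   [A] in [alpha]. *)
have /choice[eV eVP] : forall A, exists e : Kp -> set Y, alpha A ->
    (forall k, open (e k)) /\ \bigcap_k e k = h @` A.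
  move=> A; have [aA|?] := pselect (alpha A); last by exists (fun=> setT).
  have [e eP] := pseudocharacter_enum _ _ Y_T1 (sup_card_ge
    (fun A => pseudocharacter (C_alpha_image f A)) aA).
  by exists e.
have /choice[eB eBP] : forall A, exists e : Kw -> set Y, alpha A ->
    forall O y, open O -> (h @` A) y -> O y -> exists k, e k y /\ e k `<=` O.
  move=> A; have [aA|?] := pselect (alpha A); last by exists (fun=> setT).
  have [e eP] := subspace_weight_enum _ _ (sup_card_ge
    (fun A => weight (set_type (C_alpha_image f A))) aA).
  by exists e.
have [eA eAdense] := weak_covering_number_enum _ alpha_net.
pose cut A k := A `&` h @^-1` closure (eB A k).
have acut A k : alpha A -> alpha (cut A k).
  move=> aA; apply: (alpha_closed A) => //; last by move=> x [].
  (* [A] is closed, being compact in a Hausdorff space. *)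
  apply: closedI; last by apply: closed_comp (@closed_closure _ _) => z _; exact: cth.
  apply: compact_closed (alpha_compact _ aA).
  exact: regular_accessible_hausdorff.
pose W (k : Kc * Kp * Kw) : set (C_alpha Y alpha) :=
  let B := cut (eA k.1.1) k.2 in @set_open X Y alpha (B, eV B k.1.2).
apply: (@min_card_le _ _ (W @` [set k | alpha (eA k.1.1)])).
- split=> [_ [k ak <-]|].
    apply: open_set_open; first exact: acut.
    exact: (eVP _ (acut _ _ ak)).1.
  apply/seteqP; split=> [g gW|_ -> _ [k ak <-]]; last first.
    have [_ capV] := eVP _ (acut _ k.2 ak).
    by rewrite /W /set_open /= -/h -capV => y; apply.
  apply/continuousEP => x; apply: dense_eq eAdense _ _ _ x.
  + exact: regular_accessible_hausdorff.
  + exact: cts_fun.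
  + exact: cts_fun.
  move=> x /set_mem[kc akc Ax]; rewrite -/(h x).
  apply/esym; apply: contrapT.
  move=> /(regular_accessible_separation _ _ Y_T1 Y_regular)[O [oO Ohx nOgx]].
  have [|kw [Bhx BO]] := eBP _ akc _ (h x) oO _ Ohx; first by exists x.
  pose B := cut (eA kc) kw.
  have Bx : B x by split=> //; exact: subset_closure.
  have [_ capV] := eVP _ (acut _ kw akc).
  have : (h @` B) ((g : continuousType X Y) x).
    (* With [kc] and [kw] fixed, varying [kp] puts [g x] in all the open sets whose intersection is
       [f(B)]. *)
    rewrite -capV => kp _.
    have := gW (W (kc, kp, kw)); apply; last by exists x.
    by exists (kc, kp, kw).
  by move=> [z [_ /(closureS BO)] /[swap] ->].
- by apply: card_le_trans (card_image_le _ _) _; exact: card_leT.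
(* [nat] embeds in the product through the last factor, the other coordinates being constant. *)
- have /cardinal_leP[i iinj] : cardinal_le nat Kw := nat_le_infinite_value _.
  have /cardinal_leP[j _] : cardinal_le nat Kp := nat_le_infinite_value _.
  have /cardinal_leP[l _] : cardinal_le nat Kc := nat_le_infinite_value _.
  by apply/cardinal_leP; exists (fun n => (l 0, j 0, i n)) => m n [] /iinj.
Qed.
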